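(* Let $\Gamma$ be an abelian group. Then $\mathscr{M}^{gh}_\Gamma$, with objects and morphisms as defined in the context, componentwise composition $(\phi',\psi')\circ(\phi,\psi)=(\phi'\circ\phi,\psi'\circ\psi)$ and identities $(\mathrm{id}_R,\mathrm{id}_M)$, is a well-defined category.
   Context: A ring $R$ is $\Gamma$-graded if $R=\bigoplus_{\tau\in\Gamma}R_\tau$ as additive groups with $R_\tau R_\sigma\subseteq R_{\tau\sigma}$; a graded $R$-module is a (left) $R$-module $M=\bigoplus_{\tau\in\Gamma}M_\tau$ with $R_\sigma M_\tau\subseteq M_{\sigma\tau}$. A graded ring homomorphism $\phi:R\to S$ satisfies $\phi(R_\tau)\subseteq S_\tau$. $p\mathfrak{Der}^{gh}_\Gamma(R,M)$ is the set of gr-generalized derivations on $M$: pairs $(F_M,d)_{h,M}$ where $d:R\to R$ is a derivation with $d(R_\tau)\subseteq R_\tau$ for all $\tau$, and $F_M:M\to M$ is additive with $F_M(rm)=d(r)m+rF_M(m)$ for all $r\in R,m\in M$ and $F_M(M_\tau)\subseteq M_\tau$ for all $\tau$. $\mathscr{M}^{gh}_\Gamma$ has as objects the triples $(R,M,(F_M,d)_{h,M})$ where $R$ is a $\Gamma$-graded ring, $M$ is a graded $R$-module and $(F_M,d)_{h,M}\in p\mathfrak{Der}^{gh}_\Gamma(R,M)$. A morphism $(R,M,(F_M,d)_{h,M})\to(S,N,(F_N,e)_{h,N})$ is a pair $(\phi,\psi)$ where $\phi:R\to S$ is a graded ring homomorphism, $\psi:M\to N$ is $\phi$-semilinear (additive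 with $\psi(rm)=\phi(r)\psi(m)$), and $\psi\circ F_M=F_N\circ\psi$, $\phi\circ d=e\circ\phi$. *)

(* Defs.v *)
From HB Require Import structures.
From mathcomp Require Import all_boot all_order all_algebra finmap.

Set Implicit Arguments.
Unset Strict Implicit.
Unset Printing Implicit Defensive.

Import GRing.Theory.
Local Open Scope ring_scope.

(* The abelian group Gamma is a zmodType, hence written additively: the degree
   of a product is the sum of the degrees. *)

Section Grading.
Variable Gamma : zmodType.

(* V is the internal direct sum of the subgroups V_ tau: every x is the sum of
   a unique finitely supported family of homogeneous components. *)
Record direct_sum (V : zmodType) (V_ : Gamma -> V -> Prop) : Prop := {
  direct_sum0 : forall tau, V_ tau 0;
  direct_sumB : forall tau x y, V_ tau x -> V_ tau y -> V_ tau (x - y);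
  direct_sum_unique : forall x : V,
    exists! f : {fsfun Gamma -> V for fun=> 0},
      (forall tau, V_ tau (f tau)) /\ x = \sum_(tau <- finsupp f) f tau
}.

Record ring_grading (R : pzRingType) (R_ : Gamma -> R -> Prop) : Prop := {
  ring_grading_sum : direct_sum R_;
  ring_gradingM : forall tau sigma r s,
    R_ tau r -> R_ sigma s -> R_ (tau + sigma) (r * s)
}.

Record module_grading (R : pzRingType) (R_ : Gamma -> R -> Prop)
    (M : lmodType R) (M_ : Gamma -> M -> Prop) : Prop := {
  module_grading_sum : direct_sum M_;
  module_gradingZ : forall sigma tau r m,
    R_ sigma r -> M_ tau m -> M_ (sigma + tau) (r *: m)
}.

Definition degree_preserving (U V : Type) (U_ : Gamma -> U -> Prop)
    (V_ : Gamma -> V -> Prop) (f : U -> V) : Prop :=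
  forall tau x, U_ tau x -> V_ tau (f x).

Record derivation (R : pzRingType) (d : R -> R) : Prop := {
  derivation_additive : zmod_morphism d;
  derivationM : forall r s, d (r * s) = d r * s + r * d s
}.

Record gr_generalized_derivation (R : pzRingType) (R_ : Gamma -> R -> Prop)
    (M : lmodType R) (M_ : Gamma -> M -> Prop)
    (F : M -> M) (d : R -> R) : Prop := {
  ggd_derivation : derivation d;
  ggd_degree_d : degree_preserving R_ R_ d;
  ggd_additive : zmod_morphism F;
  ggd_leibniz : forall (r : R) (m : M), F (r *: m) = d r *: m + r *: F m;
  ggd_degree_F : degree_preserving M_ M_ F
}.

Record gh_object : Type := GhObject {
  gh_ring : pzRingType;
  gh_ring_comp : Gamma -> gh_ring -> Prop;
  gh_ringP : ring_grading gh_ring_comp;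
  gh_mod : lmodType gh_ring;
  gh_mod_comp : Gamma -> gh_mod -> Prop;
  gh_modP : module_grading gh_ring_comp gh_mod_comp;
  gh_F : gh_mod -> gh_mod;
  gh_d : gh_ring -> gh_ring;
  gh_derP : gr_generalized_derivation gh_ring_comp gh_mod_comp gh_F gh_d
}.

(* psi is not required to preserve degrees. *)
Record is_gh_morphism (X Y : gh_object) (phi : gh_ring X -> gh_ring Y)
    (psi : gh_mod X -> gh_mod Y) : Prop := {
  ghm_phi_additive : zmod_morphism phi;
  ghm_phi_multiplicative : monoid_morphism phi;
  ghm_phi_degree : degree_preserving (@gh_ring_comp X) (@gh_ring_comp Y) phi;
  ghm_psi_additive : zmod_morphism psi;
  ghm_psi_semilinear : forall r m, psi (r *: m) = phi r *: psi m;
  ghm_psi_F : psi \o @gh_F X = @gh_F Y \o psi;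
  ghm_phi_d : phi \o @gh_d X = @gh_d Y \o phi
}.

Definition gh_hom (X Y : gh_object) : Type :=
  {f : (gh_ring X -> gh_ring Y) * (gh_mod X -> gh_mod Y)
     | is_gh_morphism f.1 f.2}.

End Grading.

Record category (Ob : Type) (Hom : Ob -> Ob -> Type) : Type := Category {
  cat_id : forall X, Hom X X;
  cat_comp : forall X Y Z, Hom Y Z -> Hom X Y -> Hom X Z;
  cat_comp_idl : forall X Y (f : Hom X Y), cat_comp (cat_id Y) f = f;
  cat_comp_idr : forall X Y (f : Hom X Y), cat_comp f (cat_id X) = f;
  cat_compA : forall W X Y Z (h : Hom Y Z) (g : Hom X Y) (f : Hom W X),
    cat_comp h (cat_comp g f) = cat_comp (cat_comp h g) f
}.

(* Main.v *)
Require Import Defs.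
From HB Require Import structures.
From mathcomp Require Import all_boot all_order all_algebra finmap.
From Stdlib Require Import ProofIrrelevance.

(** Each condition defining a morphism says that a map commutes with some
    structure (addition, multiplication, scalars, degrees, the two derivations),
    and such conditions hold for identities and pass to composites; the
    semilinearity of a composite is over the composite of the ring maps.  The
    category laws then reduce to those of composition of functions: a morphism
    is a pair of functions together with a proof, and proof irrelevance makes
    two morphisms with the same underlying pair equal ([gh_hom_inj]).  The laws
    for the underlying pairs hold by computation, thanks to the eta rule for
    functions and the surjectivity of pairing. *)

Lemma gh_hom_inj {Gamma : zmodType} {X Y : gh_object Gamma} (f g : gh_hom X Y) :
  sval f = sval g -> f = g.
Proof. by apply: eq_sig_hprop => fg; apply: proof_irrelevance. Qed.

Lemma is_gh_morphism_id {Gamma : zmodType} (X : gh_object Gamma) :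
  is_gh_morphism (X := X) (Y := X) id id.
Proof. by split. Qed.

Lemma is_gh_morphism_comp {Gamma : zmodType} {X Y Z : gh_object Gamma}
    (phi' : gh_ring Y -> gh_ring Z) (psi' : gh_mod Y -> gh_mod Z)
    (phi : gh_ring X -> gh_ring Y) (psi : gh_mod X -> gh_mod Y) :
  is_gh_morphism phi' psi' -> is_gh_morphism phi psi ->
  is_gh_morphism (phi' \o phi) (psi' \o psi).
Proof.
move=> [addphi' [phi'1 phi'M] degphi' addpsi' psi'Z psi'F phi'd].
move=> [addphi [phi1 phiM] degphi addpsi psiZ psiF phid].
split.
- by move=> r s /=; rewrite addphi addphi'.
- by split=> [|r s] /=; rewrite ?phi1 ?phiM.
- by move=> tau r /degphi /degphi'.
- by move=> m n /=; rewrite addpsi addpsi'.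
- by move=> r m /=; rewrite psiZ psi'Z.
(* Associativity of composition holds by conversion, so each commuting square
   can be pasted to the next one by changing only the bracketing. *)
- rewrite -[LHS]/(psi' \o (psi \o @gh_F _ X)) psiF.
  by rewrite -[LHS]/((psi' \o @gh_F _ Y) \o psi) psi'F.
- rewrite -[LHS]/(phi' \o (phi \o @gh_d _ X)) phid.
  by rewrite -[LHS]/((phi' \o @gh_d _ Y) \o phi) phi'd.
Qed.

Definition gh_id {Gamma : zmodType} (X : gh_object Gamma) : gh_hom X X :=
  exist _ (id, id) (is_gh_morphism_id X).

Definition gh_comp {Gamma : zmodType} (X Y Z : gh_object Gamma)
    (g : gh_hom Y Z) (f : gh_hom X Y) : gh_hom X Z :=
  exist _ ((sval g).1 \o (sval f).1, (sval g).2 \o (sval f).2)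
    (is_gh_morphism_comp _ _ _ _ (svalP g) (svalP f)).

Lemma gh_comp_idl {Gamma : zmodType} (X Y : gh_object Gamma) (f : gh_hom X Y) :
  gh_comp X Y Y (gh_id Y) f = f.
Proof. by apply: gh_hom_inj; case: f => [[phi psi] ?]. Qed.

Lemma gh_comp_idr {Gamma : zmodType} (X Y : gh_object Gamma) (f : gh_hom X Y) :
  gh_comp X X Y f (gh_id X) = f.
Proof. by apply: gh_hom_inj; case: f => [[phi psi] ?]. Qed.

Lemma gh_compA {Gamma : zmodType} (W X Y Z : gh_object Gamma)
    (h : gh_hom Y Z) (g : gh_hom X Y) (f : gh_hom W X) :
  gh_comp W Y Z h (gh_comp W X Y g f) = gh_comp W X Z (gh_comp X Y Z h g) f.
Proof. exact: gh_hom_inj. Qed.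

Theorem theorem5p13 (Gamma : zmodType) :
  exists C : category (@gh_hom Gamma),
    (forall X : gh_object Gamma, sval (cat_id C X) = (id, id)) /\
    (forall (X Y Z : gh_object Gamma) (g : gh_hom Y Z) (f : gh_hom X Y),
        sval (cat_comp C g f) =
          ((sval g).1 \o (sval f).1, (sval g).2 \o (sval f).2)).
Proof. by exists (Category gh_comp_idl gh_comp_idr gh_compA). Qed.
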